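(* Let $a,b,\mu,\nu\geq1$ be real numbers. If $b\geq\phi_1(a)$, where $$\phi_1(a)=\frac{(a+1-a^2)+\sqrt{a^4+2a^3+7a^2+6a+1}}{2a(a+1)},$$ then $\mathbb{W}_{(\mu,a),(\nu,b)}(z)$ is starlike in $\mathbb{D}_{1/2}$.
   Context: $\mathbb{D}_{1/2}=\{z\in\mathbb{C}:|z|<1/2\}$. The normalized four parameters Wright function is $$\mathbb{W}_{(\mu,a),(\nu,b)}(z)=\sum_{k=0}^{\infty}\frac{\Gamma(a)\Gamma(b)}{\Gamma(a+k\mu)\Gamma(b+k\nu)}\,z^{k+1}.$$ A function $f$ analytic with $f(0)=0$, $f'(0)=1$ is starlike in a disk $D$ centered at $0$ if $f$ is univalent in $D$ and $f(D)$ is a star-shaped domain with respect to $0$; equivalently, $\Re\left(zf'(z)/f(z)\right)>0$ for all $z\in D$. *)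

(* Defs.v *)
From Stdlib Require Import Reals.
From Coquelicot Require Export Coquelicot.
Open Scope R_scope.

(* Euler's integral; used only at arguments x > 0, where it converges. *)
Definition Gamma (x : R) : R :=
  RInt_gen (fun t : R => Rpower t (x - 1) * exp (- t))
           (at_right 0) (Rbar_locally p_infty).

(* Coquelicot's [Series] is real-valued; a complex series is summed
   componentwise (see [CSeries_correct]). *)
Definition CSeries (u : nat -> C) : C :=
  (Series (fun k => Re (u k)), Series (fun k => Im (u k))).

Definition Wright4 (mu a nu b : R) (z : C) : C :=
  CSeries (fun k : nat =>
    (RtoC ((Gamma a * Gamma b) / (Gamma (a + INR k * mu) * Gamma (b + INR k * nu)))
     * z ^ (k + 1))%C).

Definition disk (r : R) (z : C) : Prop := Cmod z < r.

Definition image (f : C -> C) (A : C -> Prop) (w : C) : Prop :=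
  exists z : C, A z /\ f z = w.

(* Complex differentiability: the scalars are [C_AbsRing], not the reals. *)
Definition analytic_on (A : C -> Prop) (f : C -> C) : Prop :=
  forall z : C, A z -> @ex_derive C_AbsRing C_NormedModule f z.

Definition univalent_on (A : C -> Prop) (f : C -> C) : Prop :=
  analytic_on A f /\
  forall z1 z2 : C, A z1 -> A z2 -> f z1 = f z2 -> z1 = z2.

Definition connected_set (A : C -> Prop) : Prop :=
  forall U V : C -> Prop,
    open U -> open V ->
    (forall z, A z -> U z \/ V z) ->
    (exists z, A z /\ U z) -> (exists z, A z /\ V z) ->
    exists z, A z /\ U z /\ V z.

Definition domain (A : C -> Prop) : Prop :=
  (exists z, A z) /\ open A /\ connected_set A.

Definition star_shaped_0 (A : C -> Prop) : Prop :=
  A (RtoC 0) /\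
  forall (w : C) (t : R), A w -> 0 <= t <= 1 -> A (RtoC t * w)%C.

Definition starlike_in_disk (r : R) (f : C -> C) : Prop :=
  analytic_on (disk r) f /\
  f (RtoC 0) = RtoC 0 /\
  @is_derive C_AbsRing C_NormedModule f (RtoC 0) (RtoC 1) /\
  univalent_on (disk r) f /\
  domain (image f (disk r)) /\
  star_shaped_0 (image f (disk r)).

Definition phi1 (a : R) : R :=
  ((a + 1 - a ^ 2) + sqrt (a ^ 4 + 2 * a ^ 3 + 7 * a ^ 2 + 6 * a + 1))
  / (2 * a * (a + 1)).

Lemma sum_n_components (u : nat -> C) (n : nat) :
  sum_n u n = (sum_n (fun k => Re (u k)) n, sum_n (fun k => Im (u k)) n).
Proof.
  induction n as [|n IH].
  - rewrite !sum_O. now destruct (u 0%nat).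
  - rewrite !sum_Sn, IH. now destruct (u (S n)).
Qed.

Lemma CSeries_correct (u : nat -> C) (l : C) :
  @is_series C_AbsRing C_NormedModule u l -> CSeries u = l.
Proof.
  intros H. destruct l as [x y]. unfold CSeries. f_equal; apply is_series_unique.
  - apply (filterlim_ext (fun n => fst (sum_n u n))).
    + intros n. now rewrite sum_n_components.
    + apply (filterlim_comp _ _ _ (sum_n u) fst _ (locally (x, y)) (locally x) H).
      intros P [e He]. exists e. intros [p q] [Hp _]. now apply He.
  - apply (filterlim_ext (fun n => snd (sum_n u n))).
    + intros n. now rewrite sum_n_components.
    + apply (filterlim_comp _ _ _ (sum_n u) snd _ (locally (x, y)) (locally y) H).
      intros P [e He]. exists e. intros [p q] [_ Hq]. now apply He.
Qed.

(* Main.v *)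
(** Write [f z = z + sum_k d_k z^(k+2)] with [d_k >= 0].  Since [t^(y-1) - t^(x-1)]
    dominates [(y - x) (t - 1)] for [2 <= x <= y], Gamma increases on [[2, oo)], so
    [Gamma (a + k mu) >= Gamma (a + k) >= a (a+1)^(k-1) Gamma a] for [k >= 1].  Comparison
    with a geometric series gives [sum d_k <= 1]: this is exactly the condition
    [b >= phi1 a].  Because [n + 1 <= 2^n], the function [f - id] is then [2r]-Lipschitz on
    [|z| <= r <= 1/2].  For [r < 1/2] this is a contraction, whence injectivity, and
    local surjectivity by the Banach fixed point theorem.  The same estimate shows that
    [f x = lam f y] with [lam >= 1] and [|x| <= |y|] forces [x = y].  So a preimage of
    [s f z], [s < 1] close to [1], cannot have larger modulus than [z], and iterating
    these short steps towards [0] gives the star shape. *)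

Require Import Defs.
From Stdlib Require Import Reals Lra.
From Coquelicot Require Import Coquelicot.
Open Scope R_scope.

(** * Power series with small coefficients *)

Lemma Cmod_series_le (u : nat -> C) (l : C) (v : nat -> R) (s : R) :
  @is_series C_AbsRing C_NormedModule u l -> is_series v s ->
  (forall k, Cmod (u k) <= v k) -> Cmod l <= s.
Proof.
  intros Hu Hv Huv.
  assert (H : forall n, Cmod (sum_n u n) <= sum_n v n).
  { induction n as [|n IH].
    - rewrite !sum_O; apply Huv.
    - rewrite !sum_Sn; eapply Rle_trans; [apply Cmod_triangle|].
      now apply Rplus_le_compat. }
  apply (is_lim_seq_le _ _ (Cmod l) s H); [|exact Hv].
  apply (filterlim_comp _ _ _ (sum_n u) Cmod eventually (locally l)); [exact Hu|].
  exact (filterlim_norm (V := C_NormedModule) l).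
Qed.

(** Completeness of the complex plane yields some norm limit, which [CSeries_correct] then
    identifies with the componentwise sum. *)
Lemma CSeries_is_series (u : nat -> C) (v : nat -> R) :
  (forall k, Cmod (u k) <= v k) -> ex_series v ->
  @is_series C_AbsRing C_NormedModule u (CSeries u).
Proof.
  intros Huv Hv.
  destruct (ex_series_le (K := C_AbsRing) (V := C_CompleteNormedModule) u v Huv Hv)
    as [l Hl].
  now rewrite (CSeries_correct u l Hl).
Qed.

Lemma Cmod_pow_sub (x y : C) (r : R) (n : nat) :
  Cmod x <= r -> Cmod y <= r ->
  Cmod (x ^ S n - y ^ S n)%C <= INR (S n) * r ^ n * Cmod (x - y)%C.
Proof.
  intros Hx Hy.
  assert (Hr : 0 <= r) by (pose proof (Cmod_ge_0 x); lra).
  induction n as [|n IH].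
  - simpl. rewrite !Cmult_1_r. lra.
  - replace (x ^ S (S n) - y ^ S (S n))%C
      with (x * (x ^ S n - y ^ S n) + (x - y) * y ^ S n)%C by (simpl; ring).
    eapply Rle_trans; [apply Cmod_triangle|].
    rewrite !Cmod_mult, Cmod_pow.
    assert (Hp : Cmod y ^ S n <= r ^ S n)
      by (apply pow_incr; split; [apply Cmod_ge_0|exact Hy]).
    assert (H1 := Rmult_le_compat _ _ _ _ (Cmod_ge_0 x) (Cmod_ge_0 _) Hx IH).
    assert (H2 := Rmult_le_compat_l _ _ _ (Cmod_ge_0 (x - y)%C) Hp).
    rewrite (S_INR (S n)). simpl pow in *. nra.
Qed.

Lemma INR_S_le_pow2 (n : nat) : INR (S n) <= 2 ^ n.
Proof.
  induction n as [|n IH]; [simpl; lra|].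
  rewrite S_INR. pose proof (pow_R1_Rle 2 n ltac:(lra)). simpl pow. lra.
Qed.

Lemma INR_S_mult_pow_le (n : nat) (r : R) :
  0 <= r <= 1 / 2 -> INR (S n) * r ^ n <= (2 * r) ^ n.
Proof.
  intros Hr. rewrite Rpow_mult_distr.
  apply Rmult_le_compat_r; [apply pow_le; lra|apply INR_S_le_pow2].
Qed.

(** The Lipschitz factor of [z^(n+2)] on [|z| <= r], made uniform in [n]. It reaches 1 exactly at
    [r = 1/2], which is where the radius of the disk comes from. *)
Lemma INR_SS_mult_pow_le (n : nat) (r : R) :
  0 <= r <= 1 / 2 -> INR (S (S n)) * r ^ S n <= 2 * r.
Proof.
  intros Hr. eapply Rle_trans; [now apply INR_S_mult_pow_le|].
  simpl. assert ((2 * r) ^ n <= 1) by (rewrite <- (pow1 n); apply pow_incr; lra).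
  pose proof (pow_le (2 * r) n ltac:(lra)). nra.
Qed.

(** The remainders satisfy [R_(n+1) = x R_n + (n+1) y^n (x-y)^2]. With [|x| <= 1/2] and
    [(n+1) |y|^n <= 1] the constant 2 reproduces itself, since [2/2 + 1 = 2]. Uniformity in [n]
    allows summation against the coefficients. *)
Lemma Cmod_pow_taylor1 (x y : C) (n : nat) :
  Cmod x <= 1 / 2 -> Cmod y <= 1 / 2 ->
  Cmod (x ^ S n - y ^ S n - (x - y) * (RtoC (INR (S n)) * y ^ n))%C
  <= 2 * Cmod (x - y)%C ^ 2.
Proof.
  intros Hx Hy. induction n as [|n IH].
  - replace (_ - _ - _)%C with (RtoC 0) by (simpl; ring).
    rewrite Cmod_0. pose proof (pow2_ge_0 (Cmod (x - y)%C)). lra.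
  - replace (x ^ S (S n) - y ^ S (S n) - (x - y) * (RtoC (INR (S (S n))) * y ^ S n))%C
      with (x * (x ^ S n - y ^ S n - (x - y) * (RtoC (INR (S n)) * y ^ n))
            + (x - y) * (x - y) * (RtoC (INR (S n)) * y ^ n))%C
      by (rewrite (S_INR (S n)), RtoC_plus; simpl pow; simpl Cpow; ring).
    eapply Rle_trans; [apply Cmod_triangle|].
    rewrite !Cmod_mult, Cmod_pow, Cmod_R, (Rabs_pos_eq _ (pos_INR _)).
    assert (H1 : INR (S n) * Cmod y ^ n <= 1).
    { eapply Rle_trans;
        [apply INR_S_mult_pow_le; split; [apply Cmod_ge_0|exact Hy]|].
      rewrite <- (pow1 n). apply pow_incr.
      pose proof (Cmod_ge_0 y). lra. }
    assert (H2 := Rmult_le_compat _ _ _ _ (Cmod_ge_0 x) (Cmod_ge_0 _) Hx IH).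
    assert (0 <= Cmod (x - y)%C * Cmod (x - y)%C)
      by (pose proof (Cmod_ge_0 (x - y)%C); nra).
    nra.
Qed.

(* [d k] is the coefficient of [z^(k+2)]. *)
Definition tail_term (d : nat -> R) (z : C) (k : nat) : C :=
  (RtoC (d k) * z ^ S (S k))%C.

Definition tail (d : nat -> R) (z : C) : C := CSeries (tail_term d z).

Definition small_coeffs (d : nat -> R) : Prop :=
  (forall k, 0 <= d k) /\ exists s, is_series d s /\ s <= 1.

Lemma tail_is_series (d : nat -> R) (z : C) :
  small_coeffs d -> Cmod z <= 1 ->
  @is_series C_AbsRing C_NormedModule (tail_term d z) (tail d z).
Proof.
  intros [Hd [s [Hs _]]] Hz. apply (CSeries_is_series _ d); [|now exists s].
  intros k. unfold tail_term.
  rewrite Cmod_mult, Cmod_pow, Cmod_R, (Rabs_pos_eq _ (Hd k)).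
  assert (Cmod z ^ S (S k) <= 1)
    by (rewrite <- (pow1 (S (S k))); apply pow_incr; split; [apply Cmod_ge_0|lra]).
  pose proof (Hd k). nra.
Qed.

(* Termwise estimates against [d k * B] sum to [B] because the [d k] sum to at most 1. *)
Lemma Cmod_series_small_le (d : nat -> R) (u : nat -> C) (l : C) (B : R) :
  small_coeffs d -> 0 <= B ->
  @is_series C_AbsRing C_NormedModule u l ->
  (forall k, Cmod (u k) <= d k * B) -> Cmod l <= B.
Proof.
  intros [Hd [s [Hs Hs1]]] HB Hu Huk.
  assert (H : Cmod l <= B * s).
  { apply (Cmod_series_le u l (fun k => B * d k)); [exact Hu| |].
    - exact (is_series_scal (V := R_NormedModule) B d s Hs).
    - intros k. rewrite (Rmult_comm B). apply Huk. }
  nra.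
Qed.

Lemma is_series_Cminus (u v : nat -> C) (l m : C) :
  @is_series C_AbsRing C_NormedModule u l ->
  @is_series C_AbsRing C_NormedModule v m ->
  @is_series C_AbsRing C_NormedModule (fun k => u k - v k)%C (l - m)%C.
Proof. exact (is_series_minus u v l m). Qed.

Lemma is_series_Cmult_l (c : C) (u : nat -> C) (l : C) :
  @is_series C_AbsRing C_NormedModule u l ->
  @is_series C_AbsRing C_NormedModule (fun k => c * u k)%C (c * l)%C.
Proof. exact (is_series_scal c u l). Qed.

Lemma tail_lipschitz (d : nat -> R) (x y : C) (r : R) :
  small_coeffs d -> r <= 1 / 2 -> Cmod x <= r -> Cmod y <= r ->
  Cmod (tail d x - tail d y)%C <= 2 * r * Cmod (x - y)%C.
Proof.
  intros Hd Hr Hx Hy.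
  assert (Hr0 : 0 <= r) by (pose proof (Cmod_ge_0 x); lra).
  pose proof (Cmod_ge_0 (x - y)%C) as Hxy.
  apply (Cmod_series_small_le d _ _ (2 * r * Cmod (x - y)%C) Hd ltac:(nra)
    (is_series_Cminus _ _ _ _ (tail_is_series d x Hd ltac:(lra))
                              (tail_is_series d y Hd ltac:(lra)))).
  intros k. unfold tail_term.
  replace (_ - _)%C with (RtoC (d k) * (x ^ S (S k) - y ^ S (S k)))%C by ring.
  rewrite Cmod_mult, Cmod_R, (Rabs_pos_eq _ (proj1 Hd k)).
  apply Rmult_le_compat_l; [apply Hd|].
  eapply Rle_trans; [now apply (Cmod_pow_sub x y r)|].
  apply Rmult_le_compat_r; [exact Hxy|now apply INR_SS_mult_pow_le].
Qed.

Lemma tail_0 (d : nat -> R) : small_coeffs d -> tail d (RtoC 0) = RtoC 0.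
Proof.
  intros Hd. apply Cmod_eq_0, Rle_antisym; [|apply Cmod_ge_0].
  apply (Cmod_series_small_le d _ _ 0 Hd (Rle_refl 0)
    (tail_is_series d 0 Hd ltac:(rewrite Cmod_0; lra))).
  intros k. unfold tail_term. simpl. rewrite Cmult_0_l, Cmult_0_r, Cmod_0. lra.
Qed.

(** * Injectivity, growth along rays and differentiability of [id + tail] *)

Definition id_plus_tail (d : nat -> R) (z : C) : C := (z + tail d z)%C.

Lemma id_plus_tail_0 (d : nat -> R) :
  small_coeffs d -> id_plus_tail d (RtoC 0) = RtoC 0.
Proof. intros Hd. unfold id_plus_tail. rewrite (tail_0 d Hd). ring. Qed.

Lemma id_plus_tail_injective (d : nat -> R) (x y : C) :
  small_coeffs d -> disk (1 / 2) x -> disk (1 / 2) y ->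
  id_plus_tail d x = id_plus_tail d y -> x = y.
Proof.
  unfold disk, id_plus_tail. intros Hd Hx Hy Hxy.
  set (r := Rmax (Cmod x) (Cmod y)).
  assert (Hr : r < 1 / 2) by (now apply Rmax_lub_lt).
  assert (H := tail_lipschitz d x y r Hd ltac:(lra) (Rmax_l _ _) (Rmax_r _ _)).
  replace (tail d x - tail d y)%C with (- (x - y))%C in H.
  2:{ replace (tail d x) with (x + tail d x - x)%C by ring. rewrite Hxy. ring. }
  rewrite Cmod_opp in H.
  assert (H0 : Cmod (x - y)%C = 0) by (pose proof (Cmod_ge_0 (x - y)%C); nra).
  apply Cmod_eq_0 in H0.
  replace x with (x - y + y)%C by ring. rewrite H0. ring.
Qed.

(** With [<x,y>] the real inner product, [|lam y - x|^2 - |y - x|^2 = 2 (lam-1) (|y|^2 - <x,y>) +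
    (lam-1)^2 |y|^2], and [2 <x,y> <= |x|^2 + |y|^2 <= 2 |y|^2]. *)
Lemma Cmod_sub_le_dilate (x y : C) (lam : R) :
  Cmod x <= Cmod y -> 1 <= lam -> Cmod (y - x)%C <= Cmod (RtoC lam * y - x)%C.
Proof.
  intros Hxy Hlam. apply Rsqr_incr_0_var; [|apply Cmod_ge_0].
  assert (H2 : Cmod x ^ 2 <= Cmod y ^ 2)
    by (apply pow_incr; split; [apply Cmod_ge_0|exact Hxy]).
  rewrite !Rsqr_pow2. rewrite !Cmod2_alt in *.
  destruct x as [x1 x2], y as [y1 y2]. simpl in *.
  assert (0 <= (x1 - y1) ^ 2 + (x2 - y2) ^ 2)
    by (pose proof (pow2_ge_0 (x1 - y1)); pose proof (pow2_ge_0 (x2 - y2)); lra).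
  assert (Hi : x1 * y1 + x2 * y2 <= y1 ^ 2 + y2 ^ 2) by nra.
  assert (0 <= (lam - 1) * ((y1 ^ 2 + y2 ^ 2) - (x1 * y1 + x2 * y2)))
    by (apply Rmult_le_pos; lra).
  assert (0 <= (lam - 1) ^ 2 * (y1 ^ 2 + y2 ^ 2))
    by (apply Rmult_le_pos; nra).
  nra.
Qed.

(* Going outwards along a ray in the image strictly increases the modulus of the preimage.
   Writing [f = id + tail], the relation [f x = lam f y] gives
   [(lam y - x) y = y tail x - x tail y - (lam y - x) tail y],
   whose right-hand side is at most [2 |y|^2 |lam y - x|]. *)
Lemma id_plus_tail_ray_modulus (d : nat -> R) (x y : C) (lam : R) :
  small_coeffs d -> disk (1 / 2) y -> Cmod x <= Cmod y -> 1 <= lam ->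
  id_plus_tail d x = (RtoC lam * id_plus_tail d y)%C -> x = y.
Proof.
  unfold disk, id_plus_tail. intros Hd Hy Hxy Hlam Heq.
  set (rho := Cmod y) in *.
  assert (Hrho : 0 <= rho) by apply Cmod_ge_0.
  set (m := Cmod (RtoC lam * y - x)%C).
  assert (Hm : 0 <= m) by apply Cmod_ge_0.
  assert (Hmxy : Cmod (x - y)%C <= m).
  { replace (x - y)%C with (- (y - x))%C by ring. rewrite Cmod_opp.
    now apply Cmod_sub_le_dilate. }
  assert (Hmain : Cmod ((RtoC lam * y - x) * y)%C <= m * rho * (2 * rho)).
  { replace ((RtoC lam * y - x) * y)%C
      with ((y * tail d x - x * tail d y) - (RtoC lam * y - x) * tail d y)%C.
    2:{ replace (tail d x) with (x + tail d x - x)%C by ring. rewrite Heq. ring. }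
    assert (HX := tail_is_series d x Hd ltac:(lra)).
    assert (HY := tail_is_series d y Hd ltac:(unfold rho in *; lra)).
    assert (Hnn : 0 <= m * rho * (2 * rho)) by (repeat apply Rmult_le_pos; lra).
    apply (Cmod_series_small_le d _ _ _ Hd Hnn
      (is_series_Cminus _ _ _ _
        (is_series_Cminus _ _ _ _ (is_series_Cmult_l y _ _ HX) (is_series_Cmult_l x _ _ HY))
        (is_series_Cmult_l (RtoC lam * y - x)%C _ _ HY))).
    intros k. unfold tail_term.
    replace (_ - _ - _)%C
      with (RtoC (d k) * (y * x * (x ^ S k - y ^ S k) - (RtoC lam * y - x) * y ^ S (S k)))%C
      by (simpl Cpow; ring).
    rewrite Cmod_mult, Cmod_R, (Rabs_pos_eq _ (proj1 Hd k)).
    apply Rmult_le_compat_l; [apply Hd|].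
    unfold Cminus at 1. eapply Rle_trans; [apply Cmod_triangle|].
    rewrite Cmod_opp, !Cmod_mult, Cmod_pow. fold rho m.
    assert (H1 := Cmod_pow_sub x y rho k Hxy (Rle_refl _)).
    assert (H2 := INR_SS_mult_pow_le k rho ltac:(lra)).
    assert (Hp : 0 <= INR (S k) * rho ^ k)
      by (apply Rmult_le_pos; [apply pos_INR|now apply pow_le]).
    assert (H3 : Cmod (x ^ S k - y ^ S k)%C <= INR (S k) * rho ^ k * m)
      by (eapply Rle_trans; [exact H1|now apply Rmult_le_compat_l]).
    assert (H4 : rho * Cmod x * Cmod (x ^ S k - y ^ S k)%C
                 <= rho * rho * (INR (S k) * rho ^ k * m)).
    { apply Rmult_le_compat; [|apply Cmod_ge_0| |exact H3].
      - apply Rmult_le_pos; [lra|apply Cmod_ge_0].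
      - now apply Rmult_le_compat_l. }
    (* The two parts contribute [(k+1) rho^(k+2) m] and [rho^(k+2) m]; together they make [m rho]
       times [(k+2) rho^(k+1)], which is at most [2 rho]. *)
    assert (H5 := Rmult_le_compat_l (m * rho) _ _ ltac:(now apply Rmult_le_pos) H2).
    rewrite (S_INR (S k)) in H5. simpl pow in *. nra. }
  rewrite Cmod_mult in Hmain. fold m rho in Hmain.
  (* Since [2 rho < 1], the bound [m rho <= m rho (2 rho)] leaves only zero. *)
  assert (Hz : m * rho = 0) by (pose proof (Rmult_le_pos _ _ Hm Hrho); nra).
  apply Rmult_integral in Hz. destruct Hz as [Hz|Hz].
  - assert (H0 : Cmod (x - y)%C = 0) by (pose proof (Cmod_ge_0 (x - y)%C); lra).
    apply Cmod_eq_0 in H0.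
    replace x with (x - y + y)%C by ring. rewrite H0. ring.
  - rewrite Hz in Hxy.
    rewrite (Cmod_eq_0 y Hz). apply Cmod_eq_0. pose proof (Cmod_ge_0 x). lra.
Qed.

(** Summing the uniform Taylor bounds leaves a quadratic remainder for the termwise derivative. The
    value at 0 is recorded for the normalization [f'(0) = 1]. *)
Lemma id_plus_tail_derive (d : nat -> R) (z : C) :
  small_coeffs d -> disk (1 / 2) z ->
  exists l, @is_derive C_AbsRing C_NormedModule (id_plus_tail d) z l
            /\ (z = RtoC 0 -> l = RtoC 1).
Proof.
  unfold disk. intros Hd Hz.
  set (dt := fun k => (RtoC (d k) * (RtoC (INR (S (S k))) * z ^ S k))%C).
  assert (Hdt : forall k, Cmod (dt k) <= d k * (2 * Cmod z)).
  { intros k. unfold dt.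
    rewrite !Cmod_mult, Cmod_pow, !Cmod_R, (Rabs_pos_eq _ (proj1 Hd k)),
      (Rabs_pos_eq _ (pos_INR _)).
    apply Rmult_le_compat_l; [apply Hd|].
    apply INR_SS_mult_pow_le. pose proof (Cmod_ge_0 z). lra. }
  assert (Hds : @is_series C_AbsRing C_NormedModule dt (CSeries dt)).
  { apply (CSeries_is_series _ d).
    - intros k. eapply Rle_trans; [apply Hdt|].
      pose proof (proj1 Hd k). nra.
    - destruct Hd as [_ [s [Hs _]]]. now exists s. }
  exists (1 + CSeries dt)%C. split.
  - assert (Hquad : forall w, Cmod w <= 1 / 2 ->
      Cmod (id_plus_tail d w - id_plus_tail d z - (w - z) * (1 + CSeries dt))%C
      <= 2 * Cmod (w - z)%C ^ 2).
    { intros w Hw. unfold id_plus_tail.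
      replace (_ - _ - _)%C with (tail d w - tail d z - (w - z) * CSeries dt)%C by ring.
      apply (Cmod_series_small_le d _ _ (2 * Cmod (w - z)%C ^ 2) Hd
        ltac:(pose proof (pow2_ge_0 (Cmod (w - z)%C)); lra)
        (is_series_Cminus _ _ _ _
          (is_series_Cminus _ _ _ _ (tail_is_series d w Hd ltac:(lra))
                                    (tail_is_series d z Hd ltac:(lra)))
          (is_series_Cmult_l (w - z)%C _ _ Hds))).
      intros k. unfold tail_term, dt.
      replace (_ - _ - _)%C
        with (RtoC (d k) * (w ^ S (S k) - z ^ S (S k)
                            - (w - z) * (RtoC (INR (S (S k))) * z ^ S k)))%C by ring.
      rewrite Cmod_mult, Cmod_R, (Rabs_pos_eq _ (proj1 Hd k)).
      apply Rmult_le_compat_l; [apply Hd|].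
      apply Cmod_pow_taylor1; lra. }
    split; [apply (is_linear_scal_l (K := C_AbsRing) (V := C_NormedModule))|].
    intros x Hx.
    rewrite <- (is_filter_lim_locally_unique (V := AbsRing_NormedModule C_AbsRing) z x Hx).
    intros eps.
    (* The first bound turns [2 |w-z|^2] into at most [eps |w-z|]; the second keeps [w] within
       radius 1/2. *)
    assert (He : 0 < Rmin (eps / 2) (1 / 2 - Cmod z))
      by (apply Rmin_pos; [destruct eps; simpl; lra|lra]).
    exists (mkposreal _ He).
    cut (forall w : C, Cmod (w - z)%C < Rmin (eps / 2) (1 / 2 - Cmod z) ->
      Cmod (id_plus_tail d w - id_plus_tail d z - (w - z) * (1 + CSeries dt))%C
      <= eps * Cmod (w - z)%C); [exact (fun H => H)|].
    intros w Hw.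
    assert (Hw1 := Rlt_le_trans _ _ _ Hw (Rmin_l _ _)).
    assert (Hw2 := Rlt_le_trans _ _ _ Hw (Rmin_r _ _)).
    eapply Rle_trans; [apply Hquad|].
    + replace w with ((w - z) + z)%C by ring.
      eapply Rle_trans; [apply Cmod_triangle|lra].
    + pose proof (Cmod_ge_0 (w - z)%C). nra.
  - intros ->.
    cut (CSeries dt = RtoC 0); [intros ->; exact (Cplus_0_r 1)|].
    apply Cmod_eq_0, Rle_antisym; [|apply Cmod_ge_0].
    apply (Cmod_series_small_le d _ _ 0 Hd (Rle_refl 0) Hds).
    intros k. eapply Rle_trans; [apply Hdt|]. rewrite Cmod_0. lra.
Qed.

(** * Neighbourhoods in modulus and the fixed point iteration *)

Lemma locally_C_Cmod (z : C) (eps : R) :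
  0 < eps -> locally z (fun t : C => Cmod (t - z)%C < eps).
Proof.
  intros He.
  apply (locally_le_locally_norm (V := C_NormedModule) z).
  exists (mkposreal eps He). intros t Ht. exact Ht.
Qed.

Lemma locally_C_Cmod_inv (z : C) (P : C -> Prop) :
  locally z P -> exists eps : posreal, forall t, Cmod (t - z)%C < eps -> P t.
Proof.
  intros HP. apply (locally_norm_le_locally (V := C_NormedModule) z) in HP.
  destruct HP as [eps He]. exists eps. intros t Ht. now apply He.
Qed.

Lemma is_series_Cmod_lim (u : nat -> C) (l : C) :
  @is_series C_AbsRing C_NormedModule u l ->
  is_lim_seq (fun n => Cmod (sum_n u n - l)%C) 0.
Proof.
  intros Hu. apply is_lim_seq_spec. intros eps.
  assert (H := Hu _ (locally_C_Cmod l eps (cond_pos eps))).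
  unfold filtermap in H. revert H. apply filter_imp. intros n Hn.
  rewrite Rminus_0_r, Rabs_pos_eq; [exact Hn|apply Cmod_ge_0].
Qed.

(* The Banach fixed point iteration for [x = w - g x], confined to a closed ball around [z]. *)
Lemma lipschitz_perturbation_onto_ball (g : C -> C) (z w : C) (q delta : R) :
  0 <= q < 1 -> 0 <= delta ->
  (forall x y : C, Cmod (x - z)%C <= delta -> Cmod (y - z)%C <= delta ->
     Cmod (g x - g y)%C <= q * Cmod (x - y)%C) ->
  Cmod (w - (z + g z))%C <= (1 - q) * delta ->
  exists x, Cmod (x - z)%C <= delta /\ (x + g x)%C = w.
Proof.
  intros Hq Hdelta Hg Hw.
  set (x := fun n => nat_rect (fun _ => C) z (fun _ t => (w - g t)%C) n).
  assert (HxS : forall n, x (S n) = (w - g (x n))%C) by reflexivity.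
  assert (Hq0 : forall n, 0 <= q ^ n) by (intros n; apply pow_le; lra).
  (* The first bound is the partial sum of the second, so the iterates never leave the ball where
     [g] is known to contract. *)
  assert (Hinv : forall n, Cmod (x n - z)%C <= (1 - q ^ n) * delta
                        /\ Cmod (x (S n) - x n)%C <= q ^ n * ((1 - q) * delta)).
  { induction n as [|n [IH1 IH2]].
    - split.
      + change (x 0%nat) with z. replace (z - z)%C with (RtoC 0) by ring.
        rewrite Cmod_0. simpl. lra.
      + rewrite HxS. change (x 0%nat) with z.
        replace (w - g z - z)%C with (w - (z + g z))%C by ring. simpl. lra.
    - assert (H1 : Cmod (x (S n) - z)%C <= (1 - q ^ S n) * delta).
      { replace (x (S n) - z)%C with ((x (S n) - x n) + (x n - z))%C by ring.
        eapply Rle_trans; [apply Cmod_triangle|]. simpl pow. nra. }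
      split; [exact H1|].
      rewrite (HxS (S n)). rewrite (HxS n) at 2.
      replace (w - g (x (S n)) - (w - g (x n)))%C with (- (g (x (S n)) - g (x n)))%C by ring.
      rewrite Cmod_opp.
      eapply Rle_trans; [apply Hg|].
      + pose proof (Rmult_le_pos _ _ (Hq0 (S n)) Hdelta). lra.
      + pose proof (Rmult_le_pos _ _ (Hq0 n) Hdelta). lra.
      + simpl pow. rewrite Rmult_assoc. apply Rmult_le_compat_l; [lra|exact IH2]. }
  set (u := fun n => (x (S n) - x n)%C).
  assert (Hgeom : is_series (fun n => q ^ n * ((1 - q) * delta)) delta).
  { assert (H : is_series (fun n => q ^ n * ((1 - q) * delta))
                  (/ (1 - q) * ((1 - q) * delta))).
    { apply is_series_scal_r, is_series_geom. rewrite Rabs_pos_eq; lra. }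
    replace (/ (1 - q) * ((1 - q) * delta)) with delta in H by (field; lra).
    exact H. }
  assert (Hu : forall n, Cmod (u n) <= q ^ n * ((1 - q) * delta)) by (intros n; apply Hinv).
  assert (Hex : exists l : C, @is_series C_AbsRing C_NormedModule u l)
    by (exists (CSeries u); exact (CSeries_is_series u _ Hu (ex_intro _ _ Hgeom))).
  destruct Hex as [l Hser].
  assert (Hl : Cmod l <= delta) by exact (Cmod_series_le u l _ _ Hser Hgeom Hu).
  (* Telescoping; [sum_n u n] includes the index [n], hence ends at [x (S n)]. *)
  assert (Hsum : forall n, sum_n u n = (x (S n) - z)%C).
  { induction n as [|n IH]; [now rewrite sum_O|].
    rewrite sum_Sn, IH.
    assert (H : ((x (S n) - z) + (x (S (S n)) - x (S n)) = x (S (S n)) - z)%C) by ring.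
    exact H. }
  assert (Hlim1 : is_lim_seq (fun n => Cmod (x (S n) - (z + l))%C) 0).
  { apply (is_lim_seq_ext (fun n => Cmod (sum_n u n - l)%C)).
    - intros n. rewrite Hsum. f_equal. ring.
    - now apply is_series_Cmod_lim. }
  assert (Hlim0 : is_lim_seq (fun n => Cmod (x n - (z + l))%C) 0)
    by now apply is_lim_seq_incr_1.
  assert (Hzl : Cmod (z + l - z)%C <= delta)
    by (replace (z + l - z)%C with l by ring; exact Hl).
  exists (z + l)%C. split; [exact Hzl|].
  (* The residual at the limit is a constant bounded by [|x_(n+1) - (z+l)| + q |x_n - (z+l)|], which
     tends to 0. *)
  assert (Hres : Cmod (z + l + g (z + l) - w)%C <= 0).
  { apply (is_lim_seq_le (fun _ => Cmod (z + l + g (z + l) - w)%C)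
      (fun n => Cmod (x (S n) - (z + l))%C + q * Cmod (x n - (z + l))%C)
      (Cmod (z + l + g (z + l) - w)%C) 0).
    - intros n. rewrite (HxS n).
      replace (z + l + g (z + l) - w)%C
        with (- (w - g (x n) - (z + l)) + - (g (x n) - g (z + l)))%C by ring.
      eapply Rle_trans; [apply Cmod_triangle|]. rewrite !Cmod_opp.
      apply Rplus_le_compat_l, Hg; [|exact Hzl].
      eapply Rle_trans; [apply Hinv|].
      pose proof (Rmult_le_pos _ _ (Hq0 n) Hdelta). lra.
    - apply is_lim_seq_const.
    - replace (Finite 0) with (Finite (0 + q * 0)) by (f_equal; ring).
      apply is_lim_seq_plus'; [exact Hlim1|].
      now apply (is_lim_seq_scal_l _ q 0). }
  assert (H0 : (z + l + g (z + l) - w)%C = 0)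
    by (apply Cmod_eq_0, Rle_antisym; [exact Hres|apply Cmod_ge_0]).
  replace w with (z + l + g (z + l) - (z + l + g (z + l) - w))%C at 1 by ring.
  rewrite H0. ring.
Qed.

(** * Openness and star shape of the image *)

Lemma id_plus_tail_onto_ball (d : nat -> R) (z w : C) (r delta : R) :
  small_coeffs d -> 0 <= delta -> Cmod z + delta <= r -> r < 1 / 2 ->
  Cmod (w - id_plus_tail d z)%C <= (1 - 2 * r) * delta ->
  exists x, Cmod x <= r /\ id_plus_tail d x = w.
Proof.
  intros Hd Hdelta Hzr Hr Hw.
  pose proof (Cmod_ge_0 z) as Hz0.
  assert (Hin : forall x, Cmod (x - z)%C <= delta -> Cmod x <= r).
  { intros x Hx. replace x with ((x - z) + z)%C by ring.
    eapply Rle_trans; [apply Cmod_triangle|lra]. }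
  destruct (lipschitz_perturbation_onto_ball (tail d) z w (2 * r) delta) as [x [Hx Hxw]];
    [lra|exact Hdelta| |exact Hw|].
  - intros x y Hx Hy. apply tail_lipschitz; [exact Hd|lra| |]; now apply Hin.
  - exists x. split; [now apply Hin|exact Hxw].
Qed.

Lemma Cmod_id_plus_tail_le (d : nat -> R) (z : C) :
  small_coeffs d -> Cmod z <= 1 / 2 -> Cmod (id_plus_tail d z) <= 1.
Proof.
  intros Hd Hz. unfold id_plus_tail.
  assert (H := tail_lipschitz d z 0 (1 / 2) Hd ltac:(lra) Hz ltac:(rewrite Cmod_0; lra)).
  rewrite (tail_0 d Hd) in H.
  replace (tail d z - 0)%C with (tail d z) in H by ring.
  replace (z - 0)%C with z in H by ring.
  eapply Rle_trans; [apply Cmod_triangle|lra].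
Qed.

(** The step size [e0] depends on [rho] alone and the new point stays within radius [rho], so the
    step can be iterated. *)
Lemma id_plus_tail_short_contraction (d : nat -> R) (rho : R) :
  small_coeffs d -> 0 <= rho < 1 / 2 ->
  exists e0, 0 < e0 < 1 /\ forall z s, Cmod z <= rho -> 1 - e0 <= s <= 1 ->
    exists x, Cmod x <= rho /\ id_plus_tail d x = (RtoC s * id_plus_tail d z)%C.
Proof.
  intros Hd Hrho.
  (* The midpoint leaves room [delta] around [z] while keeping the contraction factor [2 r] below
     1. *)
  set (r := (rho + 1 / 2) / 2). set (delta := r - rho).
  assert (Hdelta : 0 < delta) by (unfold delta, r; lra).
  assert (Hr : r < 1 / 2) by (unfold r; lra).
  (* The bound 1/2 keeps [s] positive, so [/ s] makes sense; the other gives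
     [(1-s) |f z| <= (1 - 2 r) delta], because [|f z| <= 1]. *)
  exists (Rmin (1 / 2) ((1 - 2 * r) * delta)).
  assert (He : 0 < Rmin (1 / 2) ((1 - 2 * r) * delta)) by (apply Rmin_pos; [lra|nra]).
  pose proof (Rmin_l (1 / 2) ((1 - 2 * r) * delta)).
  pose proof (Rmin_r (1 / 2) ((1 - 2 * r) * delta)).
  split; [lra|]. intros z s Hz Hs.
  destruct (id_plus_tail_onto_ball d z (RtoC s * id_plus_tail d z)%C r delta Hd)
    as [x [Hx Hxs]]; [lra|unfold delta; lra|exact Hr| |].
  - replace (RtoC s * id_plus_tail d z - id_plus_tail d z)%C
      with (RtoC (s - 1) * id_plus_tail d z)%C by (rewrite RtoC_minus; ring).
    rewrite Cmod_mult, Cmod_R, <- Rabs_Ropp, Rabs_pos_eq by lra.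
    pose proof (Cmod_id_plus_tail_le d z Hd ltac:(lra)).
    pose proof (Cmod_ge_0 (id_plus_tail d z)). nra.
  - exists x. split; [|exact Hxs].
    (* If [|z| < |x|], then [f z = (1/s) f x] with [1/s >= 1], and the ray lemma gives [z = x]. *)
    destruct (Rle_or_lt (Cmod x) (Cmod z)) as [Hxz|Hxz]; [lra|].
    rewrite <- (id_plus_tail_ray_modulus d z x (/ s) Hd); [exact Hz| | | |].
    + unfold disk. lra.
    + lra.
    + rewrite <- Rinv_1. apply Rinv_le_contravar; lra.
    + rewrite Hxs, Cmult_assoc, <- RtoC_mult, Rinv_l by lra. ring.
Qed.

Lemma id_plus_tail_star_shaped (d : nat -> R) :
  small_coeffs d -> star_shaped_0 (image (id_plus_tail d) (disk (1 / 2))).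
Proof.
  intros Hd.
  assert (H0 : image (id_plus_tail d) (disk (1 / 2)) (RtoC 0)).
  { exists (RtoC 0). split; [|now apply id_plus_tail_0].
    unfold disk. rewrite Cmod_0. lra. }
  split; [exact H0|]. intros w t [z [Hz <-]] Ht.
  (* Products of short steps approach 0 without reaching it, so [t = 0] is separate. *)
  destruct (Req_dec t 0) as [->|Ht0]; [now rewrite Cmult_0_l|].
  unfold disk in Hz.
  destruct (id_plus_tail_short_contraction d (Cmod z) Hd
              ltac:(pose proof (Cmod_ge_0 z); lra)) as [e0 [He0 Hstep]].
  assert (Hreach : forall n s, (1 - e0) ^ n <= s <= 1 ->
    exists x, Cmod x <= Cmod z /\ id_plus_tail d x = (RtoC s * id_plus_tail d z)%C).
  { induction n as [|n IH]; intros s Hs.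
    - exists z. split; [lra|]. simpl in Hs. replace s with 1 by lra. ring.
    - assert (Hpn : 0 < (1 - e0) ^ S n) by (apply pow_lt; lra).
      (* The stop before last: [s'] is in the range of [n] steps, and the remaining factor [s / s']
         lies in [[1 - e0, 1]]. *)
      set (s' := Rmin 1 (s / (1 - e0))).
      assert (Hs' : (1 - e0) ^ n <= s' <= 1).
      { split; [|apply Rmin_l]. apply Rmin_glb.
        - pose proof (pow_incr (1 - e0) 1 n ltac:(lra)) as H. now rewrite pow1 in H.
        - apply -> Rle_div_r; [|lra]. simpl in Hs. lra. }
      assert (Hs'0 : 0 < s') by (pose proof (pow_lt (1 - e0) n ltac:(lra)); lra).
      destruct (IH s' Hs') as [y [Hy Hys]].
      destruct (Hstep y (s / s') Hy) as [x [Hx Hxs]].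
      + assert (Hss : s' * (1 - e0) <= s).
        { apply <- Rle_div_r; [|lra]. apply Rmin_r. }
        split; [apply -> Rle_div_r; lra|]. apply <- Rle_div_l; [|lra].
        rewrite Rmult_1_l. apply Rmin_glb; [lra|]. apply -> Rle_div_r; [|lra].
        pose proof (pow_lt (1 - e0) (S n) ltac:(lra)). nra.
      + exists x. split; [exact Hx|].
        rewrite Hxs, Hys, Cmult_assoc, <- RtoC_mult.
        do 2 f_equal. field. lra. }
  destruct (pow_lt_1_zero (1 - e0) ltac:(rewrite Rabs_pos_eq; lra) t ltac:(lra)) as [n Hn].
  specialize (Hn n (le_n n)). rewrite Rabs_pos_eq in Hn by (apply pow_le; lra).
  destruct (Hreach n t ltac:(lra)) as [x [Hx Hxt]].
  exists x. split; [unfold disk; lra|exact Hxt].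
Qed.

Lemma id_plus_tail_image_open (d : nat -> R) :
  small_coeffs d -> open (image (id_plus_tail d) (disk (1 / 2))).
Proof.
  intros Hd w [z [Hz <-]]. unfold disk in Hz.
  set (r := (Cmod z + 1 / 2) / 2).
  assert (Hpos : 0 < (1 - 2 * r) * (r - Cmod z)) by (unfold r; nra).
  generalize (locally_C_Cmod (id_plus_tail d z) _ Hpos). apply filter_imp.
  intros t Ht.
  destruct (id_plus_tail_onto_ball d z t r (r - Cmod z) Hd) as [x [Hx Hxt]];
    [unfold r; lra|lra|unfold r; lra|lra|].
  exists x. split; [unfold disk, r in *; lra|exact Hxt].
Qed.

Lemma open_along_ray (U : C -> Prop) (w : C) (s : R) :
  open U -> U (RtoC s * w)%C ->
  exists eta, 0 < eta /\ forall t, Rabs (t - s) < eta -> U (RtoC t * w)%C.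
Proof.
  intros HU Hs. destruct (locally_C_Cmod_inv _ _ (HU _ Hs)) as [eps He].
  pose proof (Cmod_ge_0 w). pose proof (cond_pos eps).
  (* Adding 1 keeps the denominator positive when [w = 0]. *)
  exists (eps / (Cmod w + 1)). split; [apply Rdiv_lt_0_compat; lra|].
  intros t Ht. apply He.
  replace (RtoC t * w - RtoC s * w)%C with (RtoC (t - s) * w)%C
    by (rewrite RtoC_minus; ring).
  rewrite Cmod_mult, Cmod_R.
  apply <- Rlt_div_r in Ht; [|lra]. pose proof (Rabs_pos (t - s)). nra.
Qed.

(** By symmetry 0 may be taken in [U]. Along the segment from 0 to a point [v] of [V], let [s] be
    the supremum of the parameters in [U]; the two sets meet at or near parameter [s]. *)
Lemma star_shaped_connected (A : C -> Prop) : star_shaped_0 A -> connected_set A.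
Proof.
  intros [HA0 HA].
  assert (Hray : forall U V : C -> Prop, open U -> open V ->
    (forall z, A z -> U z \/ V z) -> U (RtoC 0) -> forall v, A v -> V v ->
    exists z, A z /\ U z /\ V z).
  { intros U V HU HV Hcov HU0 v Hv HVv.
    destruct (completeness (fun t => 0 <= t <= 1 /\ U (RtoC t * v)%C)) as [s [Hub Hlub]].
    - exists 1. intros t [Ht _]. lra.
    - exists 0. split; [lra|]. now rewrite Cmult_0_l.
    - assert (Hs0 : 0 <= s) by (apply Hub; split; [lra|now rewrite Cmult_0_l]).
      assert (Hs1 : s <= 1) by (apply Hlub; intros t [Ht _]; lra).
      destruct (Hcov _ (HA v s Hv (conj Hs0 Hs1))) as [Hs|Hs].
      (* In [U], the parameter could be increased past [s] unless [s = 1], and then [v] itself is in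
         both sets. *)
      + destruct (open_along_ray U v s HU Hs) as [eta [Heta Hnear]].
        destruct (Req_dec s 1) as [->|Hne].
        * exists v. rewrite Cmult_1_l in Hs. auto.
        * exfalso.
          set (t := Rmin 1 (s + eta / 2)).
          assert (Ht : s < t) by (apply Rmin_glb_lt; lra).
          pose proof (Rmin_l 1 (s + eta / 2)). pose proof (Rmin_r 1 (s + eta / 2)).
          fold t in H, H0.
          assert (t <= s); [|lra].
          apply Hub. split; [lra|]. apply Hnear. rewrite Rabs_pos_eq; lra.
      (* In [V], some parameter of [U] lies within [eta] below [s], hence also in [V]. *)
      + destruct (open_along_ray V v s HV Hs) as [eta [Heta Hnear]].
        destruct (Classical_Prop.classic
          (exists t, (0 <= t <= 1 /\ U (RtoC t * v)%C) /\ s - eta < t)) as [Ht|Hno].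
        * destruct Ht as [t [[Ht HUt] Hst]].
          exists (RtoC t * v)%C. split; [now apply HA|]. split; [exact HUt|].
          apply Hnear. assert (t <= s) by (apply Hub; auto).
          rewrite <- Rabs_Ropp, Rabs_pos_eq; lra.
        * exfalso. assert (s <= s - eta); [|lra].
          apply Hlub. intros t Ht. apply Rnot_lt_le. intros Hlt. apply Hno. eauto. }
  intros U V HU HV Hcov [u [HAu HUu]] [v [HAv HVv]].
  destruct (Hcov _ HA0) as [H0|H0].
  - exact (Hray U V HU HV Hcov H0 v HAv HVv).
  - assert (Hcov' : forall z, A z -> V z \/ U z)
      by (intros z Hz; destruct (Hcov z Hz); auto).
    destruct (Hray V U HV HU Hcov' H0 u HAu HUu) as [z [Hz [HVz HUz]]].
    exists z. auto.
Qed.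

Lemma id_plus_tail_starlike (d : nat -> R) (f : C -> C) :
  small_coeffs d -> (forall z, disk (1 / 2) z -> id_plus_tail d z = f z) ->
  starlike_in_disk (1 / 2) f.
Proof.
  intros Hd Hf.
  assert (H0 : disk (1 / 2) (RtoC 0)) by (unfold disk; rewrite Cmod_0; lra).
  assert (Himg : forall w,
    image (id_plus_tail d) (disk (1 / 2)) w <-> image f (disk (1 / 2)) w).
  { intros w. split; intros [z [Hz <-]]; exists z; split; auto.
    symmetry. auto. }
  assert (Hstar : star_shaped_0 (image f (disk (1 / 2)))).
  { destruct (id_plus_tail_star_shaped d Hd) as [Hs0 Hs].
    split; [now apply Himg|]. intros w t Hw Ht. apply Himg, Hs; [now apply Himg|exact Ht]. }
  assert (Hder : forall z, disk (1 / 2) z ->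
    exists l, @is_derive C_AbsRing C_NormedModule f z l /\ (z = RtoC 0 -> l = RtoC 1)).
  { intros z Hz. destruct (id_plus_tail_derive d z Hd Hz) as [l [Hl Hl1]].
    exists l. split; [|exact Hl1].
    apply (is_derive_ext_loc (K := C_AbsRing) (V := C_NormedModule) (id_plus_tail d) f z l);
      [|exact Hl].
    assert (Hpos : 0 < 1 / 2 - Cmod z) by (unfold disk in Hz; lra).
    exists (mkposreal _ Hpos).
    cut (forall w : C, Cmod (w - z)%C < 1 / 2 - Cmod z -> id_plus_tail d w = f w);
      [exact (fun H => H)|].
    intros w Hw. apply Hf. unfold disk. replace w with ((w - z) + z)%C by ring.
    eapply Rle_lt_trans; [apply Cmod_triangle|lra]. }
  assert (Han : analytic_on (disk (1 / 2)) f).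
  { intros z Hz. destruct (Hder z Hz) as [l [Hl _]]. now exists l. }
  split; [exact Han|]. split; [|split; [|split; [|split]]].
  - rewrite <- (Hf _ H0). now apply id_plus_tail_0.
  - destruct (Hder _ H0) as [l [Hl Hl1]]. rewrite (Hl1 eq_refl) in Hl. exact Hl.
  - split; [exact Han|]. intros x y Hx Hy Hxy.
    rewrite <- (Hf x Hx), <- (Hf y Hy) in Hxy. now apply (id_plus_tail_injective d).
  - split; [|split].
    + exists (RtoC 0). apply Hstar.
    + apply (open_ext _ _ Himg). now apply id_plus_tail_image_open.
    + now apply star_shaped_connected.
  - exact Hstar.
Qed.

(** * The Gamma function on [[1, oo)] *)

(** Separating the endpoints at 1 reduces eventual properties of [[e, M]] to the ordered case. *)
Lemma filter_prod_pos_infty (P : R -> R -> Prop) :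
  (forall e M, 0 < e -> e <= M -> P e M) ->
  filter_prod (at_right 0) (Rbar_locally p_infty) (fun ab => P (fst ab) (snd ab)).
Proof.
  intros HP.
  apply (Filter_prod _ _ _ (fun e => 0 < e < 1) (fun M => 1 < M)).
  - exists (mkposreal 1 Rlt_0_1). intros e He He0. split; [exact He0|].
    change (Rabs (e - 0) < 1) in He. rewrite Rminus_0_r, Rabs_pos_eq in He; lra.
  - now exists 1.
  - intros e M He HM. apply HP; simpl; lra.
Qed.

Lemma ex_RInt_pos (f : R -> R) (e M : R) :
  (forall t, 0 < t -> continuous f t) -> 0 < e -> e <= M -> ex_RInt f e M.
Proof.
  intros Hf He HM. apply (ex_RInt_continuous (V := R_CompleteNormedModule)).
  intros t Ht. apply Hf. rewrite Rmin_left in Ht by exact HM. lra.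
Qed.

(* The integrals over [e, M] increase as the interval grows, so they converge to their supremum. *)
Lemma ex_RInt_gen_nonneg_bounded (f : R -> R) (B : R) :
  (forall t, 0 < t -> continuous f t) -> (forall t, 0 < t -> 0 <= f t) ->
  (forall e M, 0 < e -> e <= M -> RInt f e M <= B) ->
  ex_RInt_gen f (at_right 0) (Rbar_locally p_infty).
Proof.
  intros Hc Hpos HB.
  destruct (completeness (fun v => exists e M, 0 < e /\ e <= M /\ v = RInt f e M))
    as [l [Hub Hlub]].
  - exists B. intros v (e & M & He & HM & ->). now apply HB.
  - exists (RInt f 1 1), 1, 1. lra.
  - exists l. apply filterlimi_locally. intros eps. pose proof (cond_pos eps) as Heps.
    destruct (Classical_Prop.classic
      (exists e M, (0 < e /\ e <= M) /\ l - eps < RInt f e M)) as [H|Hno].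
    2:{ exfalso. assert (l <= l - eps); [|lra].
        apply Hlub. intros v (e & M & He & HM & ->).
        apply Rnot_lt_le. intros H. apply Hno. exists e, M. auto. }
    destruct H as (e0 & M0 & [He0 HM0] & Hl).
    apply (Filter_prod _ _ _ (fun e => 0 < e < e0) (fun M => M0 < M)).
    + exists (mkposreal e0 He0). intros e He Hepos. split; [exact Hepos|].
      change (Rabs (e - 0) < e0) in He. rewrite Rminus_0_r, Rabs_pos_eq in He; lra.
    + now exists M0.
    + intros e M He HM. simpl fst. simpl snd.
      exists (RInt f e M). split.
      * apply (RInt_correct (V := R_CompleteNormedModule)), ex_RInt_pos; [exact Hc|lra|lra].
      * assert (Hle : RInt f e M <= l) by (apply Hub; exists e, M; repeat split; lra).
        assert (Hex : forall p q, 0 < p -> p <= q -> ex_RInt f p q)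
          by (intros; now apply ex_RInt_pos).
        assert (Hnn : forall p q, 0 < p -> p <= q -> 0 <= RInt f p q).
        { intros p q Hp Hq. apply RInt_ge_0; [exact Hq|now apply Hex|].
          intros t Ht. apply Hpos. lra. }
        (* Enlarging [[e0, M0]] adds two nonnegative pieces, so the integral stays between [l - eps]
           and [l]. *)
        assert (H1 := RInt_Chasles f e e0 M (Hex e e0 ltac:(lra) ltac:(lra))
                        (Hex e0 M He0 ltac:(lra))).
        assert (H2 := RInt_Chasles f e0 M0 M (Hex e0 M0 He0 HM0)
                        (Hex M0 M ltac:(lra) ltac:(lra))).
        change plus with Rplus in *.
        pose proof (Hnn e e0 ltac:(lra) ltac:(lra)).
        pose proof (Hnn M0 M ltac:(lra) ltac:(lra)).
        change (Rabs (RInt f e M - l) < eps).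
        apply Rabs_def1; lra.
Qed.

Lemma is_RInt_gen_antiderivative (F f : R -> R) (l0 l1 : R) :
  (forall t, 0 < t -> is_derive F t (f t)) -> (forall t, 0 < t -> continuous f t) ->
  filterlim F (at_right 0) (locally l0) -> filterlim F (Rbar_locally p_infty) (locally l1) ->
  is_RInt_gen f (at_right 0) (Rbar_locally p_infty) (l1 - l0).
Proof.
  intros HF Hf H0 H1. unfold is_RInt_gen.
  apply (filterlimi_lim_ext_loc (fun ab => minus (F (snd ab)) (F (fst ab)))).
  - apply (filter_prod_pos_infty (fun e M => is_RInt f e M (minus (F M) (F e)))).
    intros e M He HM. apply (is_RInt_derive (V := R_CompleteNormedModule));
      intros t Ht; rewrite Rmin_left in Ht by exact HM; [apply HF|apply Hf]; lra.
  - apply (filterlim_comp_2 (G := locally l1) (H := locally (- l0))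
             (fun ab => F (snd ab)) (fun ab => opp (F (fst ab))) plus).
    + eapply filterlim_comp; [apply filterlim_snd|exact H1].
    + eapply filterlim_comp; [eapply filterlim_comp; [apply filterlim_fst|exact H0]|].
      apply (filterlim_opp (V := R_NormedModule)).
    + apply (filterlim_plus (V := R_NormedModule)).
Qed.

Definition Gamma_integrand (x t : R) : R := Rpower t (x - 1) * exp (- t).

Lemma Gamma_integrand_continuous (x t : R) : 0 < t -> continuous (Gamma_integrand x) t.
Proof.
  intros Ht. apply (ex_derive_continuous (V := R_NormedModule)).
  unfold Gamma_integrand, Rpower. auto_derive. exact Ht.
Qed.

(* From [ln u <= u - 1] at [u = t / (2 (y + 1))]. *)
Lemma Rpower_le_exp_half (y : R) :
  0 <= y -> exists K, 0 < K /\ forall t, 0 < t -> Rpower t y <= K * exp (t / 2).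
Proof.
  (* Chosen so that [y t / m <= t / 2], with [m > 0] even at [y = 0]. *)
  intros Hy. set (m := 2 * (y + 1)).
  exists (exp (y * (ln m - 1))). split; [apply exp_pos|].
  intros t Ht. unfold Rpower. rewrite <- exp_plus.
  assert (Hm : 0 < m) by (unfold m; lra).
  assert (Hln : ln t <= t / m + (ln m - 1)).
  { assert (Htm : 0 < t / m) by now apply Rdiv_lt_0_compat.
    assert (Hexp := exp_ineq1_le (ln (t / m))).
    rewrite exp_ln, ln_div in Hexp by assumption. lra. }
  assert (Hty : y * (t / m) <= t / 2).
  { replace (t / 2) with ((y + 1) * (t / m)) by (unfold m; field; lra).
    apply Rmult_le_compat_r; [|lra]. apply Rlt_le. now apply Rdiv_lt_0_compat. }
  assert (Hle : y * ln t <= y * (ln m - 1) + t / 2) by nra.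
  destruct Hle as [Hlt|Heq]; [left; now apply exp_increasing|right; now rewrite Heq].
Qed.

Lemma exp_half_limit_infty (K : R) :
  filterlim (fun t => K * exp (- (t / 2))) (Rbar_locally p_infty) (locally 0).
Proof.
  replace 0 with (K * 0) at 1 by ring.
  apply (filterlim_comp _ _ _ (fun t => exp (- (t / 2))) (fun v => K * v) _ (locally 0)).
  - apply (filterlim_comp _ _ _ (fun t => - (t / 2)) exp _ (Rbar_locally m_infty)).
    + intros P [M HM]. exists (- (2 * M)). intros t Ht. apply HM. lra.
    + exact is_lim_exp_m.
  - apply (filterlim_scal_r (V := R_NormedModule) K 0).
Qed.

(** For [x >= 1] the exponent [x - 1] is nonnegative, so the single majorant [K exp (- t / 2)], of
    integral at most [2 K], controls both ends. *)
Lemma ex_Gamma (x : R) : 1 <= x ->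
  is_RInt_gen (Gamma_integrand x) (at_right 0) (Rbar_locally p_infty) (Gamma x).
Proof.
  intros Hx. apply (RInt_gen_correct (V := R_CompleteNormedModule)).
  destruct (Rpower_le_exp_half (x - 1)) as [K [HK Hpow]]; [lra|].
  apply (ex_RInt_gen_nonneg_bounded _ (2 * K)).
  - intros t. apply Gamma_integrand_continuous.
  - intros t _. unfold Gamma_integrand, Rpower.
    apply Rlt_le, Rmult_lt_0_compat; apply exp_pos.
  - intros e M He HM.
    assert (HI : is_RInt (fun t => K * exp (- (t / 2))) e M
                   (minus (- (2 * K) * exp (- (M / 2))) (- (2 * K) * exp (- (e / 2))))).
    { apply (is_RInt_derive (V := R_CompleteNormedModule)
               (fun t => - (2 * K) * exp (- (t / 2)))).
      - intros t _. auto_derive; [exact I|]. unfold Rdiv. field.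
      - intros t _. apply (ex_derive_continuous (V := R_NormedModule)).
        auto_derive. exact I. }
    eapply Rle_trans.
    + apply (RInt_le _ (fun t => K * exp (- (t / 2)))); [exact HM| |eexists; exact HI|].
      * apply ex_RInt_pos; [apply Gamma_integrand_continuous|exact He|exact HM].
      * intros t Ht. unfold Gamma_integrand.
        replace (K * exp (- (t / 2))) with (K * exp (t / 2) * exp (- t)).
        2:{ rewrite Rmult_assoc, <- exp_plus. do 2 f_equal. lra. }
        apply Rmult_le_compat_r; [apply Rlt_le, exp_pos|]. apply Hpow. lra.
    + rewrite (is_RInt_unique _ _ _ _ HI).
      change (- (2 * K) * exp (- (M / 2)) - - (2 * K) * exp (- (e / 2)) <= 2 * K).
      assert (exp (- (e / 2)) < 1) by (rewrite <- exp_0; apply exp_increasing; lra).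
      pose proof (exp_pos (- (M / 2))). nra.
Qed.

Lemma filterlim_at_right_continuous (f : R -> R) (x : R) :
  continuous f x -> filterlim f (at_right x) (locally (f x)).
Proof.
  intros Hf. intros P HP. apply filter_le_within, Hf, HP.
Qed.

Lemma Gamma_unique (x l : R) :
  is_RInt_gen (Gamma_integrand x) (at_right 0) (Rbar_locally p_infty) l -> Gamma x = l.
Proof. apply (is_RInt_gen_unique (V := R_CompleteNormedModule)). Qed.

Lemma Gamma_1 : Gamma 1 = 1.
Proof.
  apply Gamma_unique.
  replace 1 with (0 - - 1) at 2 by ring.
  apply (is_RInt_gen_antiderivative (fun t => - exp (- t))).
  - intros t Ht. unfold Gamma_integrand.
    replace (1 - 1) with 0 by ring. rewrite Rpower_O by exact Ht.
    auto_derive; [exact I|]. ring.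
  - apply Gamma_integrand_continuous.
  - replace (- 1) with (- exp (- 0)) by (rewrite Ropp_0, exp_0; ring).
    apply (filterlim_at_right_continuous (fun t => - exp (- t))).
    apply (ex_derive_continuous (V := R_NormedModule) (fun t => - exp (- t)) 0).
    auto_derive. exact I.
  - apply (filterlim_le_le (F := Rbar_locally p_infty)
      (fun t => - 1 * exp (- (t / 2))) _ (fun _ => 0) 0).
    + exists 0. intros t Ht. pose proof (exp_pos (- t)). 
      assert (exp (- t) < exp (- (t / 2))) by (apply exp_increasing; lra). lra.
    + apply exp_half_limit_infty.
    + apply filterlim_const.
Qed.

(** Integration by parts: [- t^x exp (- t)] is an antiderivative of the difference of the integrands
    and vanishes at both ends. *)
Lemma Gamma_succ (x : R) : 1 <= x -> Gamma (x + 1) = x * Gamma x.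
Proof.
  intros Hx.
  assert (Hx1 := ex_Gamma (x + 1) ltac:(lra)).
  assert (H := is_RInt_gen_minus _ _ _ _ Hx1 (is_RInt_gen_scal _ x _ (ex_Gamma x Hx))).
  assert (H0 : is_RInt_gen
    (fun t => minus (Gamma_integrand (x + 1) t) (scal x (Gamma_integrand x t)))
    (at_right 0) (Rbar_locally p_infty) (0 - 0)).
  { apply (is_RInt_gen_antiderivative (fun t => - (Rpower t x * exp (- t)))).
    - intros t Ht. unfold Gamma_integrand. change scal with Rmult. simpl.
      change (is_derive (fun t => - (Rpower t x * exp (- t))) t
        (Rpower t (x + 1 - 1) * exp (- t) - x * (Rpower t (x - 1) * exp (- t)))).
      replace (x + 1 - 1) with x by ring.
      unfold Rminus at 2. rewrite Rpower_plus, Rpower_Ropp, Rpower_1 by exact Ht.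
      unfold Rpower. auto_derive; [exact Ht|]. field. lra.
    - intros t Ht. apply (continuous_minus (V := R_NormedModule)).
      + now apply Gamma_integrand_continuous.
      + apply (continuous_scal_r (V := R_NormedModule)).
        now apply Gamma_integrand_continuous.
    (* Squeeze at 0: [t^x <= t] for [0 < t < 1], as [x >= 1]. *)
    - apply (filterlim_le_le (F := at_right 0) (fun t => - t) _ (fun _ => 0) 0).
      + exists (mkposreal 1 Rlt_0_1). intros t Ht Ht0.
        change (Rabs (t - 0) < 1) in Ht. rewrite Rminus_0_r, Rabs_pos_eq in Ht by lra.
        assert (Hp : 0 < Rpower t x) by apply exp_pos.
        assert (Hpt : Rpower t x <= t).
        { rewrite <- (Rpower_1 t Ht0) at 2. unfold Rpower.
          assert (Hln : ln t < 0) by (rewrite <- ln_1; now apply ln_increasing).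
          assert (Hle : x * ln t <= 1 * ln t) by nra.
          destruct Hle as [Hlt|Heq]; [left; now apply exp_increasing|right; now rewrite Heq]. }
        assert (exp (- t) < 1) by (rewrite <- exp_0; apply exp_increasing; lra).
        pose proof (exp_pos (- t)). nra.
      + replace (Rbar_locally 0) with (locally (- 0)) by now rewrite Ropp_0.
        apply (filterlim_at_right_continuous Ropp).
        apply (filterlim_opp (V := R_NormedModule) 0).
      + apply filterlim_const.
    (* Squeeze at infinity: [t^x exp (- t) <= K exp (- t / 2)]. *)
    - destruct (Rpower_le_exp_half x) as [K [HK Hpow]]; [lra|].
      apply (filterlim_le_le (F := Rbar_locally p_infty)
        (fun t => - K * exp (- (t / 2))) _ (fun _ => 0) 0).
      + exists 0. intros t Ht.
        assert (Hp : 0 < Rpower t x) by apply exp_pos.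
        pose proof (exp_pos (- t)).
        assert (Rpower t x * exp (- t) <= K * exp (t / 2) * exp (- t))
          by (apply Rmult_le_compat_r; [lra|now apply Hpow]).
        replace (exp (- (t / 2))) with (exp (t / 2) * exp (- t))
          by (rewrite <- exp_plus; f_equal; lra).
        nra.
      + apply exp_half_limit_infty.
      + apply filterlim_const. }
  assert (HU := eq_trans
    (eq_sym (is_RInt_gen_unique (V := R_CompleteNormedModule) _ _ H0))
    (is_RInt_gen_unique (V := R_CompleteNormedModule) _ _ H)).
  change (0 - 0 = Gamma (x + 1) - x * Gamma x) in HU. lra.
Qed.

(* [t^(x-1) (t^(y-x) - 1) >= (y - x) t^(x-1) ln t >= (y - x) t ln t >= (y - x) (t - 1)];
   the lower bound integrates to [0] against [exp (- t)] because [Gamma 2 = Gamma 1]. *)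
Lemma Rpower_sub_ge (x y t : R) :
  2 <= x <= y -> 0 < t ->
  (y - x) * (t - 1) <= Rpower t (y - 1) - Rpower t (x - 1).
Proof.
  intros Hxy Ht.
  replace (y - 1) with ((x - 1) + (y - x)) by ring. rewrite Rpower_plus.
  assert (Hexp : 1 + (y - x) * ln t <= Rpower t (y - x)) by apply exp_ineq1_le.
  assert (Hpos : 0 < Rpower t (x - 1)) by apply exp_pos.
  assert (Htln : t - 1 <= t * ln t).
  { assert (H := exp_ineq1_le (- ln t)). rewrite exp_Ropp, exp_ln in H by exact Ht.
    apply (Rmult_le_compat_l t) in H; [|lra]. rewrite Rinv_r in H; lra. }
  assert (Hmono : t * ln t <= Rpower t (x - 1) * ln t).
  { replace (Rpower t (x - 1)) with (t * Rpower t (x - 2)).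
    2:{ replace (x - 1) with (1 + (x - 2)) by ring. now rewrite Rpower_plus, Rpower_1. }
    assert (Hexp2 : 1 + (x - 2) * ln t <= Rpower t (x - 2)) by apply exp_ineq1_le.
    rewrite Rmult_assoc. apply Rmult_le_compat_l; [lra|].
    destruct (Rle_or_lt 0 (ln t)) as [Hl|Hl]; [nra|].
    assert (Rpower t (x - 2) <= 1).
    { unfold Rpower. rewrite <- exp_0.
      assert (Hle : (x - 2) * ln t <= 0) by nra.
      destruct Hle as [Hlt|Heq]; [left; now apply exp_increasing|right; now rewrite Heq]. }
    nra. }
  assert ((y - x) * (t - 1) <= (y - x) * (Rpower t (x - 1) * ln t))
    by (apply Rmult_le_compat_l; lra).
  assert (Rpower t (x - 1) * (1 + (y - x) * ln t)
          <= Rpower t (x - 1) * Rpower t (y - x))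
    by (apply Rmult_le_compat_l; lra).
  nra.
Qed.

Lemma Gamma_increasing_from_2 (x y : R) : 2 <= x <= y -> Gamma x <= Gamma y.
Proof.
  intros Hxy.
  assert (Hy := ex_Gamma y ltac:(lra)). assert (Hx := ex_Gamma x ltac:(lra)).
  assert (H2 := ex_Gamma 2 ltac:(lra)). assert (H1 := ex_Gamma 1 ltac:(lra)).
  (* The zero integrand, written as a difference, so that the norm comparison [RInt_gen_norm] yields
     nonnegativity of the integral in [H]. *)
  assert (H0 := is_RInt_gen_minus _ _ _ _ H1 H1).
  assert (H := is_RInt_gen_minus _ _ _ _ (is_RInt_gen_minus _ _ _ _ Hy Hx)
    (is_RInt_gen_scal _ (y - x) _ (is_RInt_gen_minus _ _ _ _ H2 H1))).
  apply (RInt_gen_norm (V := R_CompleteNormedModule)) with (3 := H0) in H.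
  - change (Rabs (Gamma 1 - Gamma 1)
            <= Gamma y - Gamma x - (y - x) * (Gamma 2 - Gamma 1)) in H.
    replace 2 with (1 + 1) in H by ring.
    rewrite Gamma_succ, Rminus_diag, Rabs_R0 in H by lra. lra.
  - now apply (filter_prod_pos_infty (fun e M => e <= M)).
  - apply (filter_prod_pos_infty (fun e M => forall t, e <= t <= M -> _)).
    intros e M He HM t Ht.
    change (Rabs (Gamma_integrand 1 t - Gamma_integrand 1 t)
      <= Gamma_integrand y t - Gamma_integrand x t
         - (y - x) * (Gamma_integrand 2 t - Gamma_integrand 1 t)).
    rewrite Rminus_diag, Rabs_R0. unfold Gamma_integrand.
    replace (2 - 1) with 1 by ring. replace (1 - 1) with 0 by ring.
    rewrite Rpower_1, Rpower_O by lra.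
    pose proof (Rpower_sub_ge x y t Hxy ltac:(lra)) as Hp.
    apply (Rmult_le_compat_r (exp (- t))) in Hp; [|apply Rlt_le, exp_pos].
    lra.
Qed.

(** Shifting by one enters the monotone range: [x Gamma x = Gamma (x+1) >= Gamma 2 = 1]. *)
Lemma Gamma_pos (x : R) : 1 <= x -> 0 < Gamma x.
Proof.
  intros Hx.
  assert (H : Gamma 2 <= Gamma (x + 1)) by (apply Gamma_increasing_from_2; lra).
  replace 2 with (1 + 1) in H by ring.
  rewrite Gamma_succ, Gamma_1, Gamma_succ in H by lra. nra.
Qed.

(** The functional equation gives the factors [a, a+1, ..., a+k], of which all but the first are at
    least [a+1] . Monotonicity then passes to step [mu], since [a + k + 1 >= 2]. *)
Lemma Gamma_ratio_ge (a mu : R) (k : nat) :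
  1 <= a -> 1 <= mu ->
  a * (a + 1) ^ k * Gamma a <= Gamma (a + INR (S k) * mu).
Proof.
  intros Ha Hmu.
  assert (Hnat : a * (a + 1) ^ k * Gamma a <= Gamma (a + INR (S k))).
  { induction k as [|k IH].
    - change (INR 1) with 1. rewrite Gamma_succ by exact Ha. simpl. lra.
    - rewrite (S_INR (S k)), <- Rplus_assoc.
      pose proof (pos_INR k). pose proof (S_INR k).
      rewrite Gamma_succ by lra.
      pose proof (Gamma_pos a Ha). pose proof (pow_lt (a + 1) k ltac:(lra)).
      assert (0 < a * (a + 1) ^ k * Gamma a) by (repeat apply Rmult_lt_0_compat; lra).
      simpl pow. nra. }
  eapply Rle_trans; [exact Hnat|]. apply Gamma_increasing_from_2.
  pose proof (pos_INR k). rewrite S_INR. nra.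
Qed.

(** * The Wright function *)

(** [phi1 a] is the larger root in [b] of [a (a+1) b^2 + (a^2 - a - 1) b - (a+1)], the difference of
    the two sides. The inequality says that the geometric majorant of the coefficients sums to at
    most 1. *)
Lemma phi1_le_factored (a b : R) :
  1 <= a -> b >= phi1 a -> (a + 1) * (b + 1) <= a * b * ((a + 1) * (b + 1) - 1).
Proof.
  intros Ha Hphi. unfold phi1 in Hphi.
  set (D := a ^ 4 + 2 * a ^ 3 + 7 * a ^ 2 + 6 * a + 1) in *.
  assert (HD : 0 <= D).
  { unfold D. pose proof (pow_le a 4 ltac:(lra)). pose proof (pow_le a 3 ltac:(lra)).
    pose proof (pow_le a 2 ltac:(lra)). lra. }
  assert (Hden : 0 < 2 * a * (a + 1)) by nra.
  apply Rge_le in Hphi. apply (Rle_div_l _ _ _ Hden) in Hphi.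
  assert (Hs := sqrt_pos D). assert (Hss := sqrt_sqrt D HD).
  (* Completing the square: [X] is the derivative of that quadratic at [b], and [D] its
     discriminant. *)
  set (X := b * (2 * a * (a + 1)) - (a + 1 - a ^ 2)).
  assert (HX : D <= X * X).
  { rewrite <- Hss. unfold X. apply Rmult_le_compat; lra. }
  assert (Hfac : X * X - D = (4 * a * (a + 1))
    * (a * b * ((a + 1) * (b + 1) - 1) - (a + 1) * (b + 1))) by (unfold X, D; ring).
  nra.
Qed.

Definition Wright4_coeff (mu a nu b : R) (k : nat) : R :=
  (Gamma a * Gamma b) / (Gamma (a + INR k * mu) * Gamma (b + INR k * nu)).

(* The coefficients are dominated by a geometric sequence of sum
   [(a + 1) (b + 1) / (a b ((a + 1) (b + 1) - 1))]. *)
Lemma Wright4_small_coeffs (a b mu nu : R) :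
  1 <= a -> 1 <= b -> 1 <= mu -> 1 <= nu -> b >= phi1 a ->
  small_coeffs (fun k => Wright4_coeff mu a nu b (S k)).
Proof.
  intros Ha Hb Hmu Hnu Hphi.
  assert (Hfac := phi1_le_factored a b Ha Hphi).
  set (p := (a + 1) * (b + 1)) in *.
  assert (Hp : 4 <= p) by (unfold p; nra).
  assert (Hab : 1 <= a * b) by nra.
  assert (Hga := Gamma_pos a Ha). assert (Hgb := Gamma_pos b Hb).
  assert (Hbound : forall k, 0 <= Wright4_coeff mu a nu b (S k) <= / (a * b) * (/ p) ^ k).
  { intros k. unfold Wright4_coeff.
    assert (H1 := Gamma_ratio_ge a mu k Ha Hmu).
    assert (H2 := Gamma_ratio_ge b nu k Hb Hnu).
    assert (Hpa := pow_lt (a + 1) k ltac:(lra)). assert (Hpb := pow_lt (b + 1) k ltac:(lra)).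
    assert (HA : 0 < a * (a + 1) ^ k * Gamma a) by (repeat apply Rmult_lt_0_compat; lra).
    assert (HB : 0 < b * (b + 1) ^ k * Gamma b) by (repeat apply Rmult_lt_0_compat; lra).
    assert (Hle := Rmult_le_compat _ _ _ _ (Rlt_le _ _ HA) (Rlt_le _ _ HB) H1 H2).
    assert (HAB := Rmult_lt_0_compat _ _ HA HB).
    assert (Hgg := Rmult_lt_0_compat _ _ Hga Hgb).
    split; [apply Rlt_le, Rdiv_lt_0_compat; lra|].
    replace (/ (a * b) * (/ p) ^ k)
      with (Gamma a * Gamma b / (a * (a + 1) ^ k * Gamma a * (b * (b + 1) ^ k * Gamma b))).
    - apply Rmult_le_compat_l; [lra|]. now apply Rinv_le_contravar.
    - rewrite pow_inv. unfold p. rewrite Rpow_mult_distr. field. lra. }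
  assert (Hgeom : is_series (fun k => / (a * b) * (/ p) ^ k) (/ (a * b) * / (1 - / p))).
  { apply (is_series_scal (V := R_NormedModule)), is_series_geom.
    assert (/ p < 1) by (rewrite <- Rinv_1; apply Rinv_lt_contravar; lra).
    assert (0 < / p) by (apply Rinv_0_lt_compat; lra).
    rewrite Rabs_pos_eq; lra. }
  split; [apply Hbound|].
  set (c := fun k => Wright4_coeff mu a nu b (S k)) in *.
  assert (Hex : ex_series c).
  { apply (ex_series_le (K := R_AbsRing) (V := R_CompleteNormedModule) c
             (fun k => / (a * b) * (/ p) ^ k)); [|eexists; exact Hgeom].
    intros k. change (Rabs (c k) <= / (a * b) * (/ p) ^ k).
    rewrite Rabs_pos_eq; apply Hbound. }
  exists (Series c). split; [now apply Series_correct|].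
  eapply Rle_trans; [apply (Series_le c _ Hbound); eexists; exact Hgeom|].
  rewrite (is_series_unique _ _ Hgeom).
  replace (/ (a * b) * / (1 - / p)) with (p / (a * b * (p - 1))) by (field; lra).
  apply <- Rle_div_l; [lra|]. apply Rmult_lt_0_compat; lra.
Qed.

Lemma Wright4_eq_id_plus_tail (a b mu nu : R) (z : C) :
  1 <= a -> 1 <= b -> small_coeffs (fun k => Wright4_coeff mu a nu b (S k)) ->
  Cmod z <= 1 ->
  id_plus_tail (fun k => Wright4_coeff mu a nu b (S k)) z = Wright4 mu a nu b z.
Proof.
  intros Ha Hb Hd Hz. symmetry. apply CSeries_correct.
  (* The term [k = 0] is [z] itself; removing it shifts the exponent from [k+1] to the [k+2] of
     [tail_term]. *)
  apply is_series_decr_1.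
  assert (Hg : Wright4_coeff mu a nu b 0 = 1).
  { unfold Wright4_coeff. change (INR 0) with 0. rewrite !Rmult_0_l, !Rplus_0_r.
    pose proof (Gamma_pos a Ha). pose proof (Gamma_pos b Hb). field. lra. }
  unfold Wright4_coeff in Hg. rewrite Hg.
  match goal with |- is_series _ ?l =>
    replace l with (tail (fun k => Wright4_coeff mu a nu b (S k)) z) end.
  - refine (is_series_ext _ _ _ _ (tail_is_series _ z Hd Hz)).
    intros k. unfold tail_term. now rewrite Nat.add_1_r.
  - change plus with Cplus. change opp with Copp. unfold id_plus_tail. simpl. ring.
Qed.

Theorem theorem4p4 (a b mu nu : R)
  (ha : 1 <= a) (hb : 1 <= b) (hmu : 1 <= mu) (hnu : 1 <= nu)
  (hphi : b >= phi1 a) :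
  starlike_in_disk (1 / 2) (Wright4 mu a nu b).
Proof.
  assert (Hd := Wright4_small_coeffs a b mu nu ha hb hmu hnu hphi).
  apply (id_plus_tail_starlike _ _ Hd).
  intros z Hz. unfold disk in Hz. apply Wright4_eq_id_plus_tail; auto. lra.
Qed.
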